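(* If $G$ is a $3$-sparse graph with maximum degree $\Delta$, then $a'(G) \le \Delta + 2$.
   Context: All graphs are finite, simple and undirected. A graph $G$ is $3$-sparse if every edge of $G$ is incident on at least one vertex of degree at most $3$ in $G$. A proper edge coloring of $G$ assigns a color to each edge so that no two adjacent edges receive the same color. A cycle is bichromatic with respect to a proper edge coloring if its edges are colored with exactly $2$ colors. An acyclic edge coloring of $G$ is a proper edge coloring of $G$ with no bichromatic cycles. The acyclic chromatic index $a'(G)$ is the minimum number of colors required for an acyclic edge coloring of $G$. *)

(* Defs.v *)
From mathcomp Require Import all_boot.
From mathcomp Require Import boolp.

Set Implicit Arguments.
Unset Strict Implicit.
Unset Printing Implicit Defensive.

Record sgraph := SGraph {
  vertex :> finType;
  adj : rel vertex;
  adj_sym : symmetric adj;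
  adj_irr : irreflexive adj }.

Definition degree (G : sgraph) (x : G) : nat := #|[set y | adj x y]|.

(* This is 0 for the graph with no vertices. *)
Definition max_degree (G : sgraph) : nat := \max_(x : G) degree x.

Definition edge_set (G : sgraph) : {set {set G}} :=
  [set a | [exists x, exists y, adj x y && (a == [set x; y])]].

(* A type of edges, rather than all of {set G}, is the domain of edge
   colorings: with domain {set G} an edgeless graph would need one color. *)
Notation edge G := {a | a \in edge_set G}.

Definition sparse (k : nat) (G : sgraph) : Prop :=
  forall a : edge G, exists2 x : G, x \in val a & degree x <= k.

Definition proper_edge_coloring (G : sgraph) (C : finType) (c : edge G -> C)
    : Prop :=
  forall a b : edge G, a != b -> val a :&: val b != set0 -> c a != c b.

(* ucycle alone accepts the empty sequence and a single traversal of an edge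
   back and forth, whence the length condition. *)
Definition is_cycle (G : sgraph) (p : seq G) : Prop :=
  ucycle (@adj G) p /\ 2 < size p.

Definition cycle_edges (G : sgraph) (p : seq G) : {set edge G} :=
  [set a : edge G | [exists x in p, val a == [set x; next p x]]].

Definition bichromatic (G : sgraph) (C : finType) (c : edge G -> C)
    (p : seq G) : Prop :=
  #|[set c a | a in cycle_edges p]| = 2.

Definition acyclic_edge_coloring (G : sgraph) (C : finType) (c : edge G -> C)
    : Prop :=
  proper_edge_coloring c /\ forall p : seq G, is_cycle p -> ~ bichromatic c p.

Definition acyclic_edge_colorable (G : sgraph) (k : nat) : Prop :=
  exists c : edge G -> 'I_k, acyclic_edge_coloring c.

Lemma mem_edge_set (G : sgraph) (x y : G) :
  adj x y -> [set x; y] \in edge_set G.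
Proof. by move=> xy; rewrite inE; apply/existsP; exists x; apply/existsP; exists y; rewrite xy eqxx. Qed.

Lemma card_cycle_edges (G : sgraph) (p : seq G) :
  is_cycle p -> 2 < #|cycle_edges p|.
Proof.
case: p => [|x [|y [|z q]]] [/andP[pc pu]] // _.
set p := [:: x, y, z & q] in pc pu *.
have nx u : u \in p -> adj u (next p u) by move=> up; exact: next_cycle.
pose f (u : G) (up : u \in p) : edge G :=
  exist _ [set u; next p u] (mem_edge_set (nx u up)).
have fp u up : @f u up \in cycle_edges p.
  by rewrite inE; apply/existsP; exists u; rewrite up /=.
have xp : x \in p by rewrite !inE eqxx.
have yp : y \in p by rewrite !inE eqxx orbT.
have zp : z \in p by rewrite !inE eqxx !orbT.
move: (pu); rewrite /= !inE !negb_or -!andbA.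
case/and5P=> xy xz xq yz /and3P[yq zq _].
have nex : next p x = y by rewrite /= eqxx.
have ney : next p y = z by rewrite /= eq_sym (negPf xy) eqxx.
have nez : y != next p z.
  rewrite /p /= (eq_sym z x) (negPf xz) (eq_sym z y) (negPf yz).
  case: (q) yq => [|w r] /=; rewrite eqxx; first by rewrite eq_sym.
  by rewrite inE negb_or => /andP[].
have vf u up : val (@f u up) = [set u; next p u] by [].
have fxy : f x xp != f y yp.
  apply/eqP=> /(congr1 val); rewrite !vf ney => /setP/(_ x).
  by rewrite !inE eqxx (negPf xy) (negPf xz).
have fxz : f x xp != f z zp.
  apply/eqP=> /(congr1 val); rewrite !vf nex => /setP/(_ z).
  by rewrite !inE eqxx (eq_sym z x) (eq_sym z y) (negPf xz) (negPf yz).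
have fyz : f y yp != f z zp.
  apply/eqP=> /(congr1 val); rewrite !vf => /setP/(_ y).
  by rewrite !inE eqxx (negPf yz) (negPf nez).
apply/card_gt2P; exists (f x xp), (f y yp), (f z zp).
by split; split=> //; rewrite eq_sym.
Qed.

Lemma acyclic_edge_colorable_ex (G : sgraph) :
  exists k : nat, `[< acyclic_edge_colorable G k >].
Proof.
exists #|{: edge G}|; apply/asboolP; exists (@enum_rank _); split.
  by move=> a b ab _; rewrite (inj_eq enum_rank_inj).
move=> p /card_cycle_edges; rewrite /bichromatic.
by rewrite card_imset; [move=> /[swap] ->|exact: enum_rank_inj].
Qed.

Definition acyclic_chromatic_index (G : sgraph) : nat :=
  ex_minn (acyclic_edge_colorable_ex G).

(* Main.v *)
Require Import Defs.
From mathcomp Require Import all_boot.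
From mathcomp Require Import boolp zify.

(** The edges are colored one at a time with D + 2 colors, where D is the
maximum degree.  Suppose that x y is the only edge still to be colored, that
x has degree at most 3, and that all colored neighbors of y have degree at
most 3.  Let P(v) be the set of colors at v.  A color outside P(x) and P(y) is
a candidate for x y; it fails only if some color b of P(x) and P(y) continues
it into a bichromatic cycle, and then the b-neighbors of x and of y both see
the candidate ([valid_put], [blocked]).  There are more candidates than common
colors, |P(x)| <= 2, and a b-neighbor of y sees at most two colors besides b.

- No common color: any candidate works.
- Two common colors: if all candidates fail, one neighbor z of y sees two of
  them.  Recoloring y z with a third candidate leaves a single common color
  ([completable_two]).
- One common color b ([completable_one]): if all candidates fail, there are
  exactly two; they form a set K, and the b-neighbor yb of y sees exactly b and
  K.  Moreover P(x) = {b, e} with e outside P(y), and every color outside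
  {b, e} and K is in P(y).  Recoloring y yb with e is allowed, so the
  candidates must fail after this too, now because of e.  Hence the e-neighbor
  x2 of x sees K, and a color f missing at x2 is in P(y).  Suppose that x x2 can
  be recolored with f.  Before the exchange of b for e on y yb, the candidate e
  can only fail because of f; after it, so do the candidates in K.  The
  f-neighbor of y thus sees f, e and K, which are four colors
  ([completable_crossing]).  If x x2 cannot be recolored with any such f, the
  b-neighbor z of x2 sees all colors missing at x2.  Since x2 has degree at
  least 4, z has degree at most 3 and sees nothing but b and these colors.
  Then x2 z can be given the color e at the same time as x x2 is given f.

It remains to order the edges so that the assumption on x y always holds
([colorable_subrel]): edges between vertices of degree at most 3 come first,
when no other edge is colored; then the edges with a large end y, all of whose
neighbors have degree at most 3 by sparseness. *)

Set Implicit Arguments.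
Unset Strict Implicit.
Unset Printing Implicit Defensive.

(** * Partial acyclic colorings *)

Section PartialColorings.
Variables (G : sgraph) (C : finType).
Implicit Types (c : G -> G -> option C) (s t u v w x y z : G) (a b e f : C).

(** In a proper coloring the edges of two colors a and b form paths and cycles,
and the vertex set of a cycle is matched for both a and b.  Conversely, a
nonempty set that is matched for both contains a bichromatic cycle.  This makes
[col_acyclic] below a way to say that there is no bichromatic cycle, with no
mention of vertex sequences. *)
Definition matched c a (S : {set G}) :=
  forall s, s \in S -> exists2 t, t \in S & c s t = Some a.

Record valid c : Prop := Valid {
  col_sym : forall s t, c s t = c t s;
  col_adj : forall s t, c s t -> adj s t;
  col_inj : forall s t t' a, c s t = Some a -> c s t' = Some a -> t = t';
  col_acyclic : forall a b (S : {set G}),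
    a != b -> matched c a S -> matched c b S -> S = set0 }.

(** The lock keeps [inE] from unfolding membership in a palette. *)
Definition palette c v : {set C} :=
  locked [set a | [exists w, c v w == Some a]].

Definition put c u v (o : option C) : G -> G -> option C :=
  fun s t => if ((s == u) && (t == v)) || ((s == v) && (t == u)) then o
             else c s t.

Lemma paletteP c v a : reflect (exists w, c v w = Some a) (a \in palette c v).
Proof.
rewrite /palette -lock inE.
by apply: (iffP existsP) => -[w /eqP]; exists w => //; apply/eqP.
Qed.

Lemma eq_palette c c' v :
  (forall w, c v w = c' v w) -> palette c v = palette c' v.
Proof.
by move=> cc'; apply/setP => a; apply/paletteP/paletteP => -[w vw]; exists w;
  rewrite -vw cc'.
Qed.

Lemma mem_palette c v w a : c v w = Some a -> a \in palette c v.
Proof. by move=> vw; apply/paletteP; exists w. Qed.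

Lemma valid_loop c v : valid c -> c v v = None.
Proof.
move=> vc; case E: (c v v) => [a|] //.
by have := @col_adj _ vc v v; rewrite E adj_irr => /(_ isT).
Qed.

Lemma colored_neq c s t a : valid c -> c s t = Some a -> s != t.
Proof. by move=> vc st; apply/eqP => E; move: st; rewrite E valid_loop. Qed.

Lemma putC c u v o : put c u v o = put c v u o.
Proof. by apply/funext => s; apply/funext => t; rewrite /put orbC. Qed.

Lemma put_put c u v o o' : put (put c u v o) u v o' = put c u v o'.
Proof. by apply/funext => s; apply/funext => t; rewrite /put; case: ifP => // ->. Qed.

Lemma put_at c u v o : put c u v o u v = o.
Proof. by rewrite /put !eqxx. Qed.

Lemma put_end c u v o t : u != v -> t != v -> put c u v o u t = c u t.
Proof. by rewrite /put => /negPf -> /negPf ->; rewrite andbF. Qed.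

Lemma put_out c u v o s t : s != u -> s != v -> put c u v o s t = c s t.
Proof. by rewrite /put => /negPf -> /negPf ->. Qed.

Lemma palette_out c u v o s :
  s != u -> s != v -> palette (put c u v o) s = palette c s.
Proof.
by move=> su sv; apply: eq_palette => t; rewrite put_out.
Qed.

Lemma palette_put c u v a :
  u != v -> c u v = None -> palette (put c u v (Some a)) u = a |: palette c u.
Proof.
move=> uv cuv; apply/setP => b; rewrite in_setU1; apply/paletteP/predU1P.
  case=> t; have [->|tv] := eqVneq t v; first by rewrite put_at => -[]; left.
  by rewrite put_end // => /mem_palette; right.
case=> [->|/paletteP[t cut]]; first by exists v; rewrite put_at.
by exists t; rewrite put_end //; apply/eqP => E; move: cut; rewrite E cuv.
Qed.

Lemma palette_erase c u v b :
  valid c -> c u v = Some b -> palette (put c u v None) u = palette c u :\ b.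
Proof.
move=> vc cuv; have uv := colored_neq vc cuv.
apply/setP => a; rewrite in_setD1; apply/paletteP/andP => [[t]|].
  have [->|tv] := eqVneq t v; first by rewrite put_at.
  rewrite put_end // => cut; split; last exact: mem_palette cut.
  by apply/eqP => E; case/eqP: tv; apply: (col_inj vc cut); rewrite E.
case=> ab /paletteP[t cut]; exists t; rewrite put_end //.
by apply/eqP => E; move: cut ab; rewrite E cuv => -[->]; rewrite eqxx.
Qed.

Lemma palette_recolor c u v a b :
  valid c -> c u v = Some b ->
  palette (put c u v (Some a)) u = a |: (palette c u :\ b).
Proof.
move=> vc cuv; rewrite -(put_put c u v None) palette_put ?put_at //.
  by rewrite (palette_erase vc cuv).
exact: colored_neq cuv.
Qed.

Lemma palette_erase_sub c u v w : {subset palette (put c u v None) w <= palette c w}.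
Proof.
move=> a /paletteP[t]; rewrite /put; case: ifP => // _; exact: mem_palette.
Qed.

Lemma put_None c u v s t a : put c u v None s t = Some a -> c s t = Some a.
Proof. by rewrite /put; case: ifP. Qed.

Lemma palette_put_sub c u v a b w :
  b \in palette (put c u v (Some a)) w -> b = a \/ b \in palette c w.
Proof.
case/paletteP=> t; rewrite /put; case: ifP => [_ [->]|_ /mem_palette]; by [left|right].
Qed.

Lemma valid_erase c u v : valid c -> valid (put c u v None).
Proof.
move=> vc; split.
- move=> s t; rewrite /put (col_sym vc s t).
  by rewrite [(t == u) && _]andbC [(t == v) && _]andbC [in RHS]orbC.
- by move=> s t; rewrite /put; case: ifP => // _; apply: col_adj.
- by move=> s t t' a /put_None st /put_None; apply: (col_inj vc st).
move=> a b S ab Sa Sb; apply: (col_acyclic vc ab) => s sS.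
  by have [t tS /put_None] := Sa s sS; exists t.
by have [t tS /put_None] := Sb s sS; exists t.
Qed.

(** A bichromatic cycle through the new edge u v uses a second color b at u and
at v, and continues from there with edges of color a.  So it is enough to
look at the b-neighbors w of v and w' of u. *)
Lemma valid_put c u v a :
  valid c -> adj u v -> c u v = None ->
  a \notin palette c u -> a \notin palette c v ->
  (forall b w w', c v w = Some b -> c u w' = Some b ->
     a \in palette c w -> a \in palette c w' -> False) ->
  valid (put c u v (Some a)).
Proof.
move=> vc uv cuv au av free.
have nuv : u != v by apply/eqP => E; rewrite E adj_irr in uv.
have cvu : c v u = None by rewrite (col_sym vc).
have sym s t : put c u v (Some a) s t = put c u v (Some a) t s.
  rewrite /put (col_sym vc s t).
  by rewrite [(t == u) && _]andbC [(t == v) && _]andbC [in RHS]orbC.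
split=> //.
- move=> s t; rewrite /put; case: ifP => [|_ /(col_adj vc)//].
  by case/orP=> /andP[/eqP-> /eqP->] // _; rewrite adj_sym.
- move=> s t t' b; rewrite /put; case: ifP => [/orP h|_].
    move=> [<-]; case: ifP => [/orP h' _|_ /mem_palette].
      move: nuv; case: h h' => /andP[/eqP-> /eqP->] [] /andP[] => [_ /eqP->|/eqP->|/eqP->|_ /eqP->] //;
      by rewrite eqxx.
    by case: h => /andP[/eqP-> _]; rewrite ?(negPf au) ?(negPf av).
  case: ifP => [/orP h + [ab]|_]; last exact: col_inj.
  by rewrite -ab => /mem_palette; case: h => /andP[/eqP-> _];
    rewrite ?(negPf au) ?(negPf av).
(* the new edge matters only for the color a, and only if S contains both u
   and v *)
have restrict b (S : {set G}) : matched (put c u v (Some a)) b S ->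
    (u \notin S \/ v \notin S \/ b != a) -> matched c b S.
  move=> Sb h s sS; have [t tS bst] := Sb s sS; exists t => //; move: bst.
  rewrite /put; case: ifP => // /orP st [ab]; move: h; rewrite -ab eqxx.
  by case: st sS tS => /andP[/eqP-> /eqP->] -> -> [|[]].
have main b (S : {set G}) : b != a -> matched (put c u v (Some a)) a S ->
    matched (put c u v (Some a)) b S -> S = set0.
  move=> ba Sa Sb; have Sb' : matched c b S by apply: restrict Sb _; right; right.
  have [uS|uS] := boolP (u \in S); last first.
    by apply: (col_acyclic vc ba) => //; apply: restrict Sa _; left.
  have [vS|vS] := boolP (v \in S); last first.
    by apply: (col_acyclic vc ba) => //; apply: restrict Sa _; right; left.
  have [w wS cvw] := Sb' v vS; have [w' w'S cuw'] := Sb' u uS.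
  have aw z s : z \in S -> c s z = Some b -> (s == u) || (s == v) ->
      a \in palette c z.
    move=> zS csz suv; have [t tS] := Sa z zS.
    have [zu zv] : z != u /\ z != v.
      split; apply/eqP => E; move: csz; rewrite E; case/orP: suv => /eqP->;
      by rewrite ?valid_loop ?cuv ?cvu.
    by rewrite put_out // => /mem_palette.
  by case: (free b w w' cvw cuw'); [apply: aw wS cvw _|apply: aw w'S cuw' _];
    rewrite eqxx ?orbT.
move=> b b' S bb' Sb Sb'.
have [Eb|ba] := eqVneq b a.
  by rewrite Eb in bb' Sb; apply: (main b') => //; rewrite eq_sym.
have [Eb'|b'a] := eqVneq b' a; first by rewrite Eb' in Sb'; apply: (main b).
by apply: (col_acyclic vc bb'); [apply: restrict Sb _|apply: restrict Sb' _];
  right; right.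
Qed.

Lemma valid_recolor c u v a b :
  valid c -> c u v = Some b ->
  a \notin palette c u -> a \notin palette c v ->
  (forall b' w w', b' != b -> c v w = Some b' -> c u w' = Some b' ->
     a \in palette c w -> a \in palette c w' -> False) ->
  valid (put c u v (Some a)).
Proof.
move=> vc cuv au av free; rewrite -(put_put c u v None).
have uv := colored_neq vc cuv.
apply: valid_put; rewrite ?put_at //.
- exact: valid_erase.
- by apply: (col_adj vc); rewrite cuv.
- by apply: contra au => /palette_erase_sub.
- by apply: contra av => /palette_erase_sub.
move=> b' w w' vw uw' /palette_erase_sub aw /palette_erase_sub aw'.
apply: (free b' w w') aw aw'; [|exact: put_None vw|exact: put_None uw'].
have : b' \in palette (put c u v None) u by apply: mem_palette uw'.
by rewrite (palette_erase vc cuv) => /setD1P[].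
Qed.

(** If u and v share no color other than that of the edge u v, then no
bichromatic cycle goes through u v, whatever its color. *)
Lemma valid_shift c u v a b :
  valid c -> c u v = Some b ->
  a \notin palette c u -> a \notin palette c v ->
  palette c u :&: palette c v \subset [set b] ->
  valid (put c u v (Some a)).
Proof.
move=> vc cuv au av /subsetP uv; apply: valid_recolor cuv au av _ => // b' w w'.
move=> b'b vw uw' _ _; case/negP: b'b; rewrite -in_set1; apply: uv.
by rewrite inE (mem_palette vw) (mem_palette uw').
Qed.

Lemma card_palette_sub c v (N : {set G}) :
  (forall w, c v w -> w \in N) -> #|palette c v| <= #|N|.
Proof.
move=> cN.
have someI : injective (@Some C) by move=> a b [].
rewrite -(card_imset _ someI).
apply: leq_trans (leq_imset_card (c v) _); apply/subset_leq_card/subsetP => o.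
case/imsetP => a /paletteP[w cvw] ->; apply/imsetP; exists w => //.
by apply: cN; rewrite cvw.
Qed.

Lemma card_palette c v : valid c -> #|palette c v| <= degree v.
Proof.
by move=> vc; apply: card_palette_sub => w /(col_adj vc); rewrite inE.
Qed.

Lemma card_palette_hole c u v :
  valid c -> adj u v -> c u v = None -> #|palette c u| < degree u.
Proof.
move=> vc uv cuv; rewrite /degree (cardsD1 v) inE uv ltnS.
apply: card_palette_sub => w cuw; rewrite !inE (col_adj vc cuw) andbT.
by apply/eqP => E; rewrite E cuv in cuw.
Qed.

(** The coloring that includes the edge x y may differ from c on all other
edges. *)
Definition completable c x y := exists2 c', valid c' &
  forall s t, isSome (c' s t) = c s t || ((s == x) && (t == y)) || ((s == y) && (t == x)).

Definition same_domain c c' := forall s t, isSome (c' s t) = c s t.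

Lemma completable_dom c c' x y :
  same_domain c c' -> completable c' x y -> completable c x y.
Proof. by move=> cc' [c2 v2 d2]; exists c2 => // s t; rewrite d2 cc'. Qed.

Lemma same_domain_hole c c' x y :
  same_domain c c' -> c x y = None -> c' x y = None.
Proof. by move=> /(_ x y); case: (c' x y) => // a /[swap] ->. Qed.

Lemma same_domain_put c u v a :
  valid c -> c u v -> same_domain c (put c u v (Some a)).
Proof.
move=> vc cuv s t; rewrite /put; case: ifP => //.
by case/orP=> /andP[/eqP-> /eqP->]; rewrite ?(col_sym vc v) cuv.
Qed.

Lemma blocked c x y a :
  valid c -> adj x y -> c x y = None -> ~ completable c x y ->
  a \notin palette c x -> a \notin palette c y ->
  exists b w w', [/\ c y w = Some b, c x w' = Some b,
    a \in palette c w & a \in palette c w'].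
Proof.
move=> vc xy cxy ncomp ax ay; apply: contrapT => free; apply: ncomp.
exists (put c x y (Some a)).
  by apply: valid_put => // b w w' *; apply: free; exists b, w, w'.
by move=> s t; rewrite /put; case: ifP => h; rewrite -orbA h ?orbT ?orbF.
Qed.
End PartialColorings.

(** * Coloring one more edge *)

Section Completion.
Variables (G : sgraph) (C : finType) (D : nat).
Hypothesis sparseG : forall s t : G, adj s t -> degree s <= 3 \/ degree t <= 3.
Hypothesis degD : forall s : G, degree s <= D.
Hypothesis cardC : #|C| = D + 2.
Implicit Types (c : G -> G -> option C) (s t u v w x y z : G) (a b e f : C).

(** Exchanging the color b of the edge y z for e gives a second coloring that
cannot be completed either, where b is no longer at y.  So the obstruction to a
candidate a that survives this exchange uses a color other than b. *)
Lemma blocked_shift c x y z b e a :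
  valid c -> adj x y -> c x y = None -> ~ completable c x y ->
  c y z = Some b -> e \notin palette c y -> e \notin palette c z ->
  palette c y :&: palette c z \subset [set b] ->
  a \notin palette c x -> a \notin palette c y -> a != e ->
  exists b' w w', [/\ b' != b, put c y z (Some e) y w = Some b',
    c x w' = Some b', a \in palette c w & a \in palette c w'].
Proof.
move=> vc xy cxy ncomp cyz ey ez yz ax ay ae.
have v2 := valid_shift vc cyz ey ez yz.
have dom2 : same_domain c (put c y z (Some e)).
  by apply: same_domain_put; rewrite // cyz.
have nyz := colored_neq vc cyz.
have nxy : x != y by apply/eqP => E; rewrite E adj_irr in xy.
have nxz : x != z by apply/eqP => E; rewrite -E (col_sym vc) cxy in cyz.
have [||||b' [w [w' [yw xw aw aw']]]] := @blocked _ _ _ x y a v2 xy.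
- exact: same_domain_hole dom2 cxy.
- by move=> /(completable_dom dom2).
- by rewrite palette_out.
- by apply: contra ay => /palette_put_sub[ae'|//]; rewrite ae' eqxx in ae.
have old s : a \in palette (put c y z (Some e)) s -> a \in palette c s.
  by case/palette_put_sub=> // ae'; rewrite ae' eqxx in ae.
exists b', w, w'; split; [|done| |exact: old|exact: old]; last first.
  by rewrite -xw put_out.
apply/eqP => b'b; rewrite b'b in yw.
have [wz|wz] := eqVneq w z.
  move: yw; rewrite wz put_at => -[eb].
  by rewrite eb (mem_palette cyz) in ey.
rewrite put_end // in yw; case/eqP: wz; exact: col_inj vc _ _ _ _ yw cyz.
Qed.

(** The common colors are b and f, and e can replace b on the edge y yb.  The
color e is a candidate before this replacement, and it is not seen from yb, so
only f can obstruct it.  After the replacement, b cannot obstruct the candidates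
in K.  So the f-neighbor yf would see f, e and K. *)
Lemma completable_crossing c x y yb yf b f e (K : {set C}) :
  valid c -> adj x y -> c x y = None -> palette c x = [set b; f] ->
  c y yb = Some b -> c y yf = Some f -> degree yf <= 3 -> 
  palette c yb = b |: K -> 1 < #|K| ->
  (forall a, a \in K -> a \notin palette c x :|: palette c y) ->
  e \notin palette c x -> e \notin palette c y -> e \notin palette c yb ->
  completable c x y.
Proof.
move=> vc xy cxy Px cyb cyf df Pyb K1 Kfree ex ey eyb.
apply: contrapT => ncomp.
have fy := mem_palette cyf; have nef : e != f by apply: contraNneq ey => ->.
have eyf : e \in palette c yf.
  have [b' [w [w' [yw xw ew _]]]] := blocked vc xy cxy ncomp ex ey.
  have := mem_palette xw; rewrite Px => /set2P[] E; rewrite E in yw.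
    by rewrite (col_inj vc yw cyb) (negPf eyb) in ew.
  by rewrite (col_inj vc yw cyf) in ew.
have sub : palette c y :&: palette c yb \subset [set b].
  apply/subsetP => a /setIP[ay]; rewrite Pyb => /setU1P[->|/Kfree].
    by rewrite set11.
  by rewrite !inE negb_or => /andP[_]; rewrite ay.
have Kyf a : a \in K -> a \in palette c yf.
  move=> aK; have := Kfree a aK; rewrite in_setU negb_or => /andP[ax ay].
  have ae : a != e by apply: contraNneq eyb => <-; rewrite Pyb setU1r.
  have [b' [w [w' [b'b yw xw aw _]]]] :=
    blocked_shift vc xy cxy ncomp cyb ey eyb sub ax ay ae.
  have := mem_palette xw; rewrite Px => /set2P[] E; first by rewrite E eqxx in b'b.
  rewrite E in yw; have [wyb|wyb] := eqVneq w yb.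
    by move: yw; rewrite wyb put_at => -[ef]; rewrite ef eqxx in nef.
  rewrite put_end // in yw; first by rewrite (col_inj vc yw cyf) in aw.
  exact: colored_neq cyb.
have : e |: (f |: K) \subset palette c yf.
  apply/subsetP => a /setU1P[->|/setU1P[->|/Kyf]] //.
  by apply: (@mem_palette _ _ _ _ y); rewrite (col_sym vc).
move=> /subset_leq_card; rewrite !cardsU1 in_setU1 (negPf nef).
have -> : e \notin K by apply: contra eyb; rewrite Pyb; exact: setU1r.
have -> : f \notin K by apply/negP => /Kfree; rewrite in_setU fy orbT.
by move: (card_palette yf vc) df K1; clear; lia.
Qed.

(** The key case.  The proof recolors the edge from x to its neighbor x2 of the
color e that is not at y, so as to reach the situation of
[completable_crossing]. *)
Lemma completable_one c x y b :
  valid c -> adj x y -> c x y = None -> degree x <= 3 ->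
  (forall w, c y w -> degree w <= 3) ->
  palette c x :&: palette c y = [set b] -> completable c x y.
Proof.
move=> vc xy cxy dx dy Pxy; apply: contrapT => ncomp.
have [bx byP] : b \in palette c x /\ b \in palette c y.
  by apply/setIP; rewrite Pxy set11.
have [x1 cx1] := paletteP _ _ _ bx; have [yb cyb] := paletteP _ _ _ byP.
have nxy : x != y by apply/eqP => E; rewrite E adj_irr in xy.
have yx : adj y x by rewrite adj_sym.
have cyx : c y x = None by rewrite (col_sym vc).
have nyyb := colored_neq vc cyb.
have nxyb : x != yb by apply/eqP => E; rewrite E cyb in cyx.
set K := ~: (palette c x :|: palette c y).
have Kyb a : a \in K -> a \in palette c yb.
  rewrite in_setC in_setU negb_or => /andP[ax ay].
  have [b' [w [w' [yw xw aw _]]]] := blocked vc xy cxy ncomp ax ay.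
  have : b' \in [set b] by rewrite -Pxy inE (mem_palette yw) (mem_palette xw).
  by move=> /set1P E; rewrite E in yw; rewrite (col_inj vc yw cyb) in aw.
have bK : b \notin K by rewrite in_setC in_setU bx.
have bKyb : b |: K \subset palette c yb.
  apply/subsetP => a /setU1P[->|/Kyb//].
  by apply: (@mem_palette _ _ _ _ y); rewrite (col_sym vc).
have dyb : #|palette c yb| <= 3.
  by apply: leq_trans (card_palette yb vc) (dy _ _); rewrite cyb.
have [cardK cardPx] : #|K| = 2 /\ #|palette c x| = 2.
  have := subset_leq_card bKyb; rewrite cardsU1 bK.
  have := cardsUI (palette c x) (palette c y); rewrite Pxy cards1.
  have := cardsC (palette c x :|: palette c y); rewrite -/K cardC.
  have := card_palette_hole vc xy cxy; have := card_palette_hole vc yx cyx.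
  move: (degD y) dx dyb; clear; lia.
have Pyb : palette c yb = b |: K.
  by apply/esym/eqP; rewrite eqEcard bKyb cardsU1 bK cardK.
have [e eb Px] : exists2 e, e != b & palette c x = [set b; e].
  move: cardPx; rewrite (cardsD1 b) bx => -[/eqP/cards1P[e Pe]].
  exists e; last by rewrite -(setD1K bx) Pe.
  by have := set11 e; rewrite -Pe => /setD1P[].
have ex : e \in palette c x by rewrite Px set22.
have ey : e \notin palette c y.
  apply: contra eb => ey; rewrite -in_set1 -Pxy inE ex; exact: ey.
have eK : e \notin K by rewrite in_setC in_setU ex.
have eyb : e \notin palette c yb by rewrite Pyb in_setU1 negb_or eb.
have [x2 cx2] := paletteP _ _ _ ex.
have cx2x : c x2 x = Some e by rewrite (col_sym vc).
have Kfree a : a \in K -> a \notin palette c x :|: palette c y.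
  by rewrite in_setC.
have sub : palette c y :&: palette c yb \subset [set b].
  apply/subsetP => a /setIP[ay]; rewrite Pyb => /setU1P[->|/Kfree].
    by rewrite set11.
  by rewrite !inE negb_or => /andP[_]; rewrite ay.
have Kx2 a : a \in K -> a \in palette c x2.
  move=> aK; have := Kfree a aK; rewrite in_setU negb_or => /andP[ax ay].
  have ae : a != e by apply: contraNneq eK => <-.
  have [b' [w [w' [b'b _ xw _ aw]]]] :=
    blocked_shift vc xy cxy ncomp cyb ey eyb sub ax ay ae.
  have := mem_palette xw; rewrite Px => /set2P[] E.
    by rewrite E eqxx in b'b.
  by rewrite E in xw; rewrite (col_inj vc xw cx2) in aw.
have ex2 : e \in palette c x2 := mem_palette cx2x.
have nx2y : x2 != y by apply/eqP => E; rewrite E cxy in cx2.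
have nx2yb : x2 != yb by apply: contraNneq eyb => <-.
have nxx2 := colored_neq vc cx2.
set M := ~: palette c x2.
have cardM : 1 < #|M|.
  have := cardsC (palette c x2); rewrite -/M cardC.
  by move: (card_palette x2 vc) (degD x2); clear; lia.
(* it remains to recolor x x2 with some f != b missing at x2, changing nothing
   at y and at yb *)
have finish c' f : valid c' -> same_domain c c' -> f \in M -> f != b ->
    palette c' x = [set b; f] -> (forall w, c' y w = c y w) ->
    palette c' yb = palette c yb -> False.
  move=> v' d' fM fb Px' c'y Pyb'.
  have fx2 : f \notin palette c x2 by move: fM; rewrite in_setC.
  have ef : e != f by apply: contraNneq fx2 => <-.
  have fy : f \in palette c y.
    have fx : f \notin palette c x.
      by rewrite Px !inE negb_or fb eq_sym ef.
    have : f \notin K by apply: contra fx2 => /Kx2.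
    by rewrite in_setC negbK in_setU (negPf fx).
  have Py' : palette c' y = palette c y.
    by apply: eq_palette => w; rewrite c'y.
  have [yf cyf] := paletteP _ _ _ fy.
  apply: ncomp; apply: (completable_dom d').
  apply: (@completable_crossing c' x y yb yf b f e K) => //.
  - exact: same_domain_hole d' cxy.
  - by rewrite c'y.
  - by rewrite c'y.
  - by apply: dy; rewrite cyf.
  - by rewrite Pyb'.
  - by rewrite cardK.
  - move=> a aK; have := Kfree a aK.
    rewrite Py' Px' Px !inE !negb_or -!andbA => /and3P[-> _ ->].
    rewrite andbT /=.
    by apply: contraNneq fx2 => <-; exact: Kx2.
  - by rewrite Px' !inE negb_or eb.
  - by rewrite Py'.
  - by rewrite Pyb'.
have [[f [fM fb ffree]]|stuck] := pselect (exists f, [/\ f \in M, f != b &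
    forall z, c x2 z = Some b -> f \notin palette c z]).
  have fx2 : f \notin palette c x2 by move: fM; rewrite in_setC.
  have fx : f \notin palette c x.
    by rewrite Px !inE negb_or fb; apply: contraNneq fx2 => ->.
  apply: (finish (put c x x2 (Some f)) f) => //.
  - apply: (valid_recolor vc cx2 fx fx2) => b' w w' b'e xw x2w' fw _.
    have := mem_palette x2w'; rewrite Px => /set2P[] E; last by rewrite E eqxx in b'e.
    by rewrite E in xw; rewrite (negPf (ffree w xw)) in fw.
  - by apply: same_domain_put; rewrite // cx2.
  - rewrite (palette_recolor f vc cx2) Px setUC [[set b; e]]setUC.
    by rewrite setU1K // in_set1.
  - by move=> w; rewrite put_out // eq_sym.
  - by rewrite palette_out // eq_sym.
have Mz f : f \in M -> f != b -> exists2 z, c x2 z = Some b & f \in palette c z.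
  move=> fM fb; apply: contrapT => nz; apply: stuck; exists f; split=> // z x2z.
  by apply/negP => fz; apply: nz; exists z.
have [f0 f0M f0b] : exists2 f, f \in M & f != b.
  have : 0 < #|M :\ b| by move: (cardsD1 b M) cardM; clear; lia.
  by case/card_gt0P=> f /setD1P[]; exists f.
have [z cx2z f0z] := Mz f0 f0M f0b.
have bx2 := mem_palette cx2z.
have bM : b \notin M by rewrite in_setC negbK.
have bMz : b |: M \subset palette c z.
  apply/subsetP => f /setU1P[->|fM].
    by apply: (@mem_palette _ _ _ _ x2); rewrite (col_sym vc).
  have [|z' cx2z' fz] := Mz f fM; first by apply: contraNneq bM => <-.
  by rewrite (col_inj vc cx2z cx2z').
(* x2 sees the four colors b, e and K, so it is a vertex of large degree *)
have dz : degree z <= 3.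
  have [|big|//] := @sparseG x2 z; first by apply: (col_adj vc); rewrite cx2z.
  have : b |: (e |: K) \subset palette c x2.
    by apply/subsetP => a /setU1P[->|/setU1P[->|/Kx2]].
  move=> /subset_leq_card; rewrite !cardsU1 in_setU1 negb_or eq_sym eb bK eK.
  by move: (card_palette x2 vc) big cardK; clear; lia.
have Pz : palette c z = b |: M.
  apply/esym/eqP; rewrite eqEcard bMz cardsU1 bM.
  by move: (card_palette z vc) dz cardM; clear; lia.
have nx2z := colored_neq vc cx2z.
have nzx : z != x.
  by apply/eqP => E; move: eb; rewrite E cx2x in cx2z; case: cx2z => ->; rewrite eqxx.
have nzy : z != y.
  apply/eqP => E; case/eqP: nx2yb; apply: (col_inj vc _ cyb).
  by rewrite (col_sym vc) -E.
have f0x2 : f0 \notin palette c x2 by move: f0M; rewrite in_setC.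
have nzyb : z != yb.
  apply: contraNneq f0x2 => E; apply: Kx2.
  by move: f0z; rewrite E Pyb in_setU1 (negPf f0b).
have ez : e \notin palette c z.
  by rewrite Pz in_setU1 negb_or eb in_setC negbK.
have f0e : f0 != e by apply: contraNneq f0x2 => ->.
(* x x2 is erased first: e becomes free at x2, and b is then the only color
   that x2 and z share *)
pose c0 := put c x x2 None; pose c1 := put c0 x2 z (Some e).
have v0 : valid c0 by apply: valid_erase.
have P0x2 : palette c0 x2 = palette c x2 :\ e.
  by rewrite /c0 putC (palette_erase vc cx2x).
have P0z : palette c0 z = palette c z by rewrite palette_out // eq_sym.
have c0x2z : c0 x2 z = Some b by rewrite /c0 putC put_end // eq_sym.
have v1 : valid c1.
  apply: (valid_shift v0 c0x2z); rewrite ?P0z ?P0x2 ?setD11 //.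
  apply/subsetP => a /setIP[/setD1P[_ ax2]]; rewrite Pz => /setU1P[->|].
    by rewrite set11.
  by rewrite in_setC ax2.
have P1x : palette c1 x = [set b].
  rewrite /c1 palette_out // 1?eq_sym //.
  by rewrite /c0 (palette_erase vc cx2) Px setUC setU1K // in_set1.
have P1x2 : palette c1 x2 = e |: (palette c x2 :\ e :\ b).
  by rewrite /c1 (palette_recolor _ v0 c0x2z) P0x2.
have c1x : c1 x x2 = None.
  by rewrite /c1 /c0 put_out ?put_at // eq_sym.
apply: (finish (put c1 x x2 (Some f0)) f0) => //.
- apply: (valid_put v1); rewrite ?P1x ?in_set1 //.
  + by apply: (col_adj vc); rewrite cx2.
  + by rewrite P1x2 !inE (negPf f0e) (negPf f0x2) !andbF.
  move=> b' w w' x2w xw' _ _; have := mem_palette xw'; rewrite P1x => /set1P E.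
  have := mem_palette x2w; rewrite E P1x2 in_setU1 setD11 orbF.
  by rewrite eq_sym (negPf eb).
- move=> s t; rewrite /put; case: ifP.
    by case/orP=> /andP[/eqP-> /eqP->]; rewrite ?cx2 ?cx2x.
  rewrite /c1 /c0 {1}/put; case: ifP.
    by case/orP=> /andP[/eqP-> /eqP->]; rewrite ?[c z x2](col_sym vc) ?cx2z.
  by rewrite /put => _ ->.
- by rewrite palette_put // P1x setUC.
- by move=> w; rewrite put_out /c1 1?put_out /c0 1?put_out // eq_sym.
- by rewrite palette_out /c1 1?palette_out /c0 1?palette_out // eq_sym.
Qed.

(** The neighbor yb has degree at most 3, so it sees b and exactly two
candidates.  Giving a third candidate g to the edge y yb leaves e as the only
color common to x and y. *)
Lemma completable_two c x y yb b e (K := ~: (palette c x :|: palette c y)) :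
  valid c -> adj x y -> c x y = None -> degree x <= 3 ->
  (forall w, c y w -> degree w <= 3) ->
  palette c x = [set b; e] -> b != e -> e \in palette c y ->
  c y yb = Some b -> 2 < #|K| -> 1 < #|K :&: palette c yb| ->
  completable c x y.
Proof.
move=> vc xy cxy dx dy Px be ey cyb K2 Kyb.
have nyyb := colored_neq vc cyb.
have nxy : x != y by apply/eqP => E; rewrite E adj_irr in xy.
have nxyb : x != yb by apply/eqP => E; rewrite -E (col_sym vc) cxy in cyb.
have bx : b \in palette c x by rewrite Px set21.
have Pyb : palette c yb = b |: (K :&: palette c yb).
  apply/esym/eqP; rewrite eqEcard cardsU1 !inE bx /=; apply/andP; split.
    apply/subsetP => a /setU1P[->|/setIP[]//].
    by apply: (@mem_palette _ _ _ _ y); rewrite (col_sym vc).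
  have := card_palette yb vc; have := dy yb; rewrite cyb => /(_ isT); lia.
have [g gK gyb] : exists2 g, g \in K & g \notin palette c yb.
  have : 0 < #|K :\: palette c yb|.
    have := cardsID (palette c yb) K.
    have := cardsU1 b (K :&: palette c yb); rewrite -Pyb !inE bx /=.
    have := card_palette yb vc; have := dy yb; rewrite cyb => /(_ isT); lia.
  by case/card_gt0P=> g /setDP[]; exists g.
have /norP[gx gy] : ~~ ((g \in palette c x) || (g \in palette c y)).
  by rewrite -in_setU -in_setC.
have sub : palette c y :&: palette c yb \subset [set b].
  apply/subsetP => a /setIP[ay]; rewrite Pyb => /setU1P[->|]; first by rewrite set11.
  by rewrite !inE ay orbT.
have dom2 : same_domain c (put c y yb (Some g)).
  by apply: same_domain_put; rewrite // cyb.
apply: (completable_dom dom2); apply: (@completable_one _ _ _ e) => //.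
- exact: valid_shift cyb gy gyb sub.
- exact: same_domain_hole dom2 cxy.
- by move=> w; rewrite dom2; exact: dy.
rewrite palette_out // (palette_recolor _ vc cyb) Px.
have eg : e != g by apply: contraNneq gy => <-.
apply/setP => a; rewrite !inE; have [->|ae] := eqVneq a e.
  by rewrite !orbT [e == b]eq_sym (negPf be) ey orbT.
have [->|//] := eqVneq a b.
by rewrite /= orbF; apply/negbTE; apply: contraNneq gx => <-.
Qed.

(** The number of candidates exceeds the number of common colors, because
(deg x - 1) + (deg y - 1) < D + 2. *)
Lemma completable_hole c x y :
  valid c -> adj x y -> c x y = None -> degree x <= 3 ->
  (forall w, c y w -> degree w <= 3) -> completable c x y.
Proof.
move=> vc xy cxy dx dy; apply: contrapT => ncomp.
have yx : adj y x by rewrite adj_sym.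
have cyx : c y x = None by rewrite (col_sym vc).
set K := ~: (palette c x :|: palette c y).
have cardK : #|palette c x :&: palette c y| < #|K|.
  have := cardsUI (palette c x) (palette c y).
  have := cardsC (palette c x :|: palette c y); rewrite -/K cardC.
  have := card_palette_hole vc xy cxy; have := card_palette_hole vc yx cyx.
  by have := degD y; lia.
have Px2 : #|palette c x| <= 2.
  by have := card_palette_hole vc xy cxy; lia.
have blk a : a \in K -> exists b w, [/\ b \in palette c x, b \in palette c y,
    c y w = Some b & a \in palette c w].
  rewrite in_setC in_setU negb_or => /andP[ax ay].
  have [b [w [w' [yw xw aw _]]]] := blocked vc xy cxy ncomp ax ay.
  by exists b, w; split=> //; [apply: mem_palette xw|apply: mem_palette yw].
have Isub : palette c x :&: palette c y \subset palette c x by apply: subsetIl.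
have := subset_leq_card Isub.
case EI : #|_| => [|[|[|n]]]; last by lia.
- have [a aK] : exists a, a \in K by apply/card_gt0P; lia.
  have [b [w [bx byP _ _]]] := blk a aK.
  by have := cards0_eq EI; move/setP/(_ b); rewrite !inE bx byP.
- by move/eqP/cards1P: EI => [b Pxy] _; apply: ncomp; apply: completable_one Pxy.
move=> Px2'; rewrite EI in cardK.
have IP : palette c x :&: palette c y = palette c x.
  by apply/eqP; rewrite eqEcard Isub EI.
have xsuby : {subset palette c x <= palette c y}.
  by apply/subsetP; rewrite -IP subsetIr.
have /cards2P[b [e [be Px]]] : #|palette c x| == 2 by rewrite -IP EI.
have byP : b \in palette c y by apply: xsuby; rewrite Px set21.
have ey : e \in palette c y by apply: xsuby; rewrite Px set22.
have [yb cyb] := paletteP _ _ _ byP; have [ye cye] := paletteP _ _ _ ey.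
have Ksub : K \subset (K :&: palette c yb) :|: (K :&: palette c ye).
  apply/subsetP => a aK; have [b' [w [bx' _ yw aw]]] := blk a aK.
  rewrite -setIUr inE aK inE; move: bx'; rewrite Px => /set2P[] E; rewrite E in yw.
    by rewrite -(col_inj vc yw cyb) aw.
  by rewrite -(col_inj vc yw cye) aw orbT.
have [h|h] := leqP 2 #|K :&: palette c yb|.
  by apply: ncomp; apply: (completable_two vc xy cxy dx dy Px be ey cyb).
apply: ncomp; apply: (@completable_two c x y ye e b) => //.
- by rewrite Px setUC.
- by rewrite eq_sym.
by move: (subset_leq_card Ksub) h cardK; rewrite -/K cardsU; clear; lia.
Qed.

(** * Coloring the whole graph *)

Definition colorable (r : rel G) := exists2 c : G -> G -> option C,
  valid c & forall s t, isSome (c s t) = r s t.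

(** The induction removes an edge with an end y of degree above 3 as long as
there is one; all neighbors of y then have degree at most 3 by sparseness.
When there is none left, all ends of the remaining edges have degree at most
3.  Degrees are those of the whole graph, which makes the hypotheses stable
under removal of edges. *)
Lemma colorable_subrel n (r : rel G) :
  symmetric r -> subrel r (@adj G) -> #|[set p | r p.1 p.2]| <= n ->
  colorable r.
Proof.
elim: n r => [|n IH] r rsym radj rn.
  have r0 s t : r s t = false.
    apply/negP => rst; move: rn; rewrite leqn0 cards_eq0 => /eqP/setP/(_ (s, t)).
    by rewrite !inE rst.
  exists (fun _ _ => None) => //; split=> // a b S _ Sa _.
  by apply/eqP; apply: contraPT isT => /set0Pn[s /Sa[]].
have step x y : r x y -> degree x <= 3 -> (forall w, r y w -> degree w <= 3) ->
    colorable r.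
  move=> rxy dx dy.
  pose r' s t := r s t && ~~ (((s == x) && (t == y)) || ((s == y) && (t == x))).
  have [|||c vc cr'] := IH r'.
  - move=> s t; rewrite /r' (rsym s t); congr (_ && ~~ _).
    by rewrite [in RHS]orbC; congr (_ || _); rewrite andbC.
  - by move=> s t /andP[/radj].
  - rewrite -ltnS; apply: leq_trans rn; apply: proper_card; apply/properP; split.
      by apply/subsetP => p; rewrite !inE => /andP[].
    by exists (x, y); rewrite !inE //= /r' !eqxx andbF.
  have [||//||c' vc' c'r] := @completable_hole c x y vc.
  - exact: radj.
  - by have := cr' x y; rewrite /r' !eqxx andbF; case: (c x y).
  - by move=> w; rewrite cr' => /andP[/dy].
  exists c' => // s t; rewrite c'r cr' /r' -orbA.
  have : ((s == x) && (t == y)) || ((s == y) && (t == x)) -> r s t.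
    by case/orP=> /andP[/eqP-> /eqP->]; rewrite // rsym.
  by case: (r s t); case: orb => // /(_ isT).
have [[y [w [ryw ybig]]]|small] :=
    pselect (exists y w, r y w /\ ~~ (degree y <= 3)).
  have dy t : r y t -> degree t <= 3.
    by move=> /radj /sparseG[yt|//]; rewrite yt in ybig.
  by apply: (@step w y); rewrite 1?rsym //; exact: dy.
have dr s t : r s t -> degree s <= 3.
  by move=> rst; apply: contrapT => /negP st; apply: small; exists s, t.
have [[x [y rxy]]|none] := pselect (exists x y, r x y).
  apply: (@step x y) => //; first exact: dr rxy.
  by move=> w; rewrite rsym; exact: dr.
apply: (IH r) => //; rewrite (_ : [set _ | _] = set0) ?cards0 //.
by apply/setP => p; rewrite !inE; apply/negP => rp; apply: none; exists p.1, p.2.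
Qed.
End Completion.

(** The vertices of a bichromatic cycle form a set that is matched for both of
its colors: the two edges at a vertex of the cycle are distinct, because the
cycle has at least three vertices, so they have different colors. *)
Lemma acyclic_coloring_of_partial (G : sgraph) k (c : G -> G -> option 'I_k.+1) :
  valid c -> (forall s t, isSome (c s t) = adj s t) ->
  acyclic_edge_colorable G k.+1.
Proof.
move=> vc cadj.
pose col (a : edge G) := odflt ord0
  [pick h | [exists s, exists t, (val a == [set s; t]) && (c s t == Some h)]].
have colE (a : edge G) s t : val a = [set s; t] -> adj s t ->
    c s t = Some (col a).
  move=> aE; rewrite -cadj; case cst: (c s t) => [h|] // _; congr Some.
  rewrite /col; case: pickP => [h' /existsP[s' /existsP[t' /andP[]]]|/(_ h)]; last first.
    by move/existsP => []; exists s; apply/existsP; exists t; rewrite aE cst !eqxx.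
  rewrite aE => /eqP E /eqP cst'.
  have nst := colored_neq vc cst; have nst' := colored_neq vc cst'.
  have : s \in [set s'; t'] by rewrite -E set21.
  have : t \in [set s'; t'] by rewrite -E set22.
  move=> /set2P[] Et /set2P[] Es; rewrite Et Es ?eqxx // in nst cst.
    by move: cst; rewrite (col_sym vc) cst' => -[].
  by move: cst; rewrite cst' => -[].
have edgeE (a : edge G) s : s \in val a ->
    exists2 t, val a = [set s; t] & adj s t.
  have := valP a; rewrite inE => /existsP[u /existsP[v /andP[uv /eqP aE]]].
  rewrite aE => /set2P[]->; first by exists v.
  by exists u; rewrite 1?setUC // adj_sym.
exists col; split.
  move=> a b ab /set0Pn[s /setIP[sa sb]]; apply: contraNneq ab => Eab.
  have [t aE st] := edgeE a s sa; have [t' bE st'] := edgeE b s sb.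
  have cst := colE a s t aE st; have cst' := colE b s t' bE st'.
  apply/eqP/val_inj; rewrite aE bE; congr [set s; _].
  by apply: (col_inj vc cst); rewrite Eab.
move=> p [/andP[pc pu] p2] /eqP/cards2P[h1 [h2 [h12 Ecol]]].
have nextE s : s \in p -> c s (next p s) = Some h1 \/ c s (next p s) = Some h2.
  move=> sp; have sn := next_cycle pc sp.
  pose a : edge G := exist _ [set s; next p s] (mem_edge_set sn).
  rewrite (colE a s (next p s)) //.
  have : col a \in [set h1; h2].
    rewrite -Ecol; apply: imset_f; rewrite inE; apply/existsP; exists s.
    by rewrite sp /=.
  by move=> /set2P[]->; [left|right].
have prevE s : s \in p -> c s (prev p s) = Some h1 \/ c s (prev p s) = Some h2.
  move=> sp; rewrite (col_sym vc); have := nextE (prev p s).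
  by rewrite mem_prev next_prev //; apply.
have np s : s \in p -> next p s != prev p s.
  move=> sp; have [i q Eq] := rot_to sp.
  have uq : uniq (s :: q) by rewrite -Eq rot_uniq.
  have sq : 2 < size (s :: q) by rewrite -Eq size_rot.
  rewrite -(next_rot i pu) -(prev_rot i pu) Eq.
  case: q uq sq {Eq} => [|y [|z q]] // /andP[sq /andP[yq _]] _.
  rewrite next_nth prev_nth mem_head (memNindex sq) /= eqxx.
  rewrite -[size q]/(size (z :: q)).-1 nth_last /=.
  by apply: contraNneq yq => ->; exact: mem_last.
have dist s : s \in p ->
  (c s (next p s) = Some h1 /\ c s (prev p s) = Some h2) \/
  (c s (next p s) = Some h2 /\ c s (prev p s) = Some h1).
  move=> sp; have npn := np s sp.
  case: (nextE s sp) (prevE s sp) => En [] Ep; [|by left|by right|];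
    by rewrite (col_inj vc En Ep) eqxx in npn.
have p0 : [set s in p] = set0.
  apply: (col_acyclic vc h12) => s; rewrite inE => sp.
    by case: (dist s sp) => -[En Ep]; [exists (next p s)|exists (prev p s)];
      rewrite // inE ?mem_next ?mem_prev.
  by case: (dist s sp) => -[En Ep]; [exists (prev p s)|exists (next p s)];
    rewrite // inE ?mem_next ?mem_prev.
case: p p2 p0 {pc pu Ecol nextE prevE np dist} => // s p _ /setP/(_ s).
by rewrite !inE eqxx.
Qed.

Theorem corollary1 (G : sgraph) (sparseG : sparse 3 G) :
  acyclic_chromatic_index G <= max_degree G + 2.
Proof.
have sparse_pair (s t : G) : adj s t -> degree s <= 3 \/ degree t <= 3.
  move=> st; have [x] := sparseG (exist (fun a => a \in edge_set G) _ (mem_edge_set st)).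
  by case/set2P=> ->; [left|right].
have degD (s : G) : degree s <= max_degree G by exact: leq_bigmax.
have [c vc cadj] := colorable_subrel sparse_pair degD (card_ord _)
  (@adj_sym G) (fun _ _ => id) (leqnn _).
rewrite /acyclic_chromatic_index; case: ex_minnP => m _; apply; apply/asboolP.
by move: c vc cadj; rewrite addn2 => c; exact: acyclic_coloring_of_partial.
Qed.
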